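(* For every integer $\ell\ge 0$ there is a constant $C=C(\ell)>0$ such that the following holds. For every positive integer $n$, every Sidon set $S\subset[1,n]$ and every finite arithmetic progression $P\subset[1,n]$, $$\left|\sum_{a\in S\cap P} a^\ell-\frac{|S|}{n}\sum_{a\in P}a^\ell\right|\le C\,n^\ell\,\Phi(S,n)\log(2n).$$
   Context: $[1,n]$ denotes $\{1,2,\ldots,n\}$. A set $S\subset\mathbb{Z}$ is a Sidon set if all sums $a+b$, with $(a,b)\in S^2$ regarded as unordered pairs (with $a=b$ allowed), are distinct; i.e. $a+b=c+d$ with $a,b,c,d\in S$ implies $\{a,b\}=\{c,d\}$. A finite arithmetic progression is a finite set of integers of the form $\{x,x+d,\ldots,x+(k-1)d\}$ with $d\ge 1$, $k\ge 0$ (empty and one-point sets are allowed). For a Sidon set $S\subset[1,n]$ define $$\Phi(S,n)=n^{1/2}\left(\left|1-\frac{|S|}{n^{1/2}}\right|+n^{-1/4}\right)^{1/2}.$$ *)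

(* Defs.v *)
From HB Require Import structures.
From mathcomp Require Import all_boot all_order all_algebra.
From mathcomp Require Import finmap.
From mathcomp Require Import all_classical all_reals all_analysis.

Set Implicit Arguments.
Unset Strict Implicit.
Unset Printing Implicit Defensive.

Import Order.TTheory GRing.Theory Num.Theory.

Local Open Scope ring_scope.

Definition in_interval1 (n : nat) (A : {fset int}) : Prop :=
  {in A, forall a : int, 1 <= a <= n%:Z}.

Definition sidon (S : {fset int}) : Prop :=
  forall a b c d : int, a \in S -> b \in S -> c \in S -> d \in S ->
    a + b = c + d -> [fset a; b]%fset = [fset c; d]%fset.

(* [k = 0] gives the empty progression and [k = 1] the singletons. *)
Definition finite_AP (P : {fset int}) : Prop :=
  exists (x d : int) (k : nat),
    1 <= d /\ P = [fset (x + i%:Z * d)%R | i in iota 0 k]%fset.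

Definition Phi (R : realType) (S : {fset int}) (n : nat) : R :=
  let N : R := n%:R in
  N `^ (1 / 2) *
  (`|1 - #|` S|%:R / N `^ (1 / 2)| + N `^ (- (1 / 4))) `^ (1 / 2).

(* Main.v *)
(* With f the indicator of S, s = |S| and t = n^(1/4), slide a window of u terms
   of step d, A_j = \sum_(h < u) f (j + h d). The Sidon property gives
   \sum_j A_j^2 <= u s + u^2, while \sum_j A_j = u s, so the variance of A around
   u s / n is small when s is close to t^2. Averaging the count of S on the
   progression over the u translates by multiples of d costs only O(sqrt u), since
   a Sidon set has O(sqrt u) points in a progression of length u. Cauchy-Schwarz
   with u about t^3 / d then bounds the discrepancy by O(Phi); progressions with
   d > t^3 have O(t) terms and are trivial. Abel summation passes from the case
   l = 0 to all l. *)
Require Import Defs.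
From HB Require Import structures.
From mathcomp Require Import all_boot all_order all_algebra.
From mathcomp Require Import finmap.
From mathcomp Require Import all_classical all_reals all_analysis.
From mathcomp Require Import ring lra zify.

Set Implicit Arguments.
Unset Strict Implicit.
Unset Printing Implicit Defensive.

Import Order.TTheory GRing.Theory Num.Theory.

Local Open Scope ring_scope.

(** * Sidon sets: differences, counts in progressions, correlations *)

Lemma sidon_diff (S : {fset int}) (a b c e : int) :
  sidon S -> a \in S -> b \in S -> c \in S -> e \in S ->
  a != b -> a - b = c - e -> a = c.
Proof.
move=> sS aS bS cS eS /eqP neq_ab eq_diff.
have /fsetP/(_ a) : [fset a; e]%fset = [fset c; b]%fset by apply: sS => //; lia.
by rewrite !inE eqxx => /esym/orP[/eqP //|/eqP /neq_ab].
Qed.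

Lemma sum_bool_card (R : pzSemiRingType) (T : finType) (p : pred T) :
  \sum_(i : T) (p i)%:R = #|p|%:R :> R.
Proof.
by rewrite -natr_sum -sum1_card [in RHS]big_mkcond; congr _%:R; apply: eq_bigr => i _; case: (p i).
Qed.

(** Double counting of pairs of indices in [G]: a diagonal pair is recorded by its index, and an
    off-diagonal pair is determined by its difference. This gives at most [u] and [2 * u] values
    respectively. *)
Lemma sidon_AP_card (R : numDomainType) (S : {fset int}) (x : int) (d u : nat) :
  sidon S -> (0 < d)%N ->
  (\sum_(i < u) (x + (i * d)%:Z \in S)%:R : R) ^+ 2 <= 3 * u%:R.
Proof.
move=> sS d_gt0.
pose G := [set i : 'I_u | x + (i * d)%:Z \in S].
rewrite sum_bool_card -natrX -natrM ler_nat.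
have -> : #|(fun i : 'I_u => x + (i * d)%:Z \in S)| = #|G|.
  by apply: eq_card => i; rewrite !inE.
rewrite expnS expn1 -cardsX.
(* The difference of the indices is translated by [u] so that it stays in the natural numbers. *)
have diff_lt (i j : 'I_u) : (i + (u - j) < 2 * u)%N.
  by have := ltn_ord i; have := ltn_ord j; lia.
pose h (p : 'I_u * 'I_u) : 'I_(2 * u) + 'I_u :=
  if p.1 == p.2 then inr p.1 else inl (Ordinal (diff_lt p.1 p.2)).
have h_inj : {in finset.setX G G &, injective h}.
  move=> [i j] [i' j']; rewrite !inE /h /= => /andP[iS jS] /andP[i'S j'S].
  case: eqVneq => [->|neq_ij]; case: eqVneq => [->|neq_ij'] // [] eq_h; first by rewrite eq_h.
  have jP := ltn_ord j; have j'P := ltn_ord j'.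
  have eq_diff : (i + j' = i' + j)%N by lia.
  have eq_diff_d : (i * d + j' * d = i' * d + j * d)%N by rewrite -!mulnDl eq_diff.
  have neq_x : x + (i * d)%:Z != x + (j * d)%:Z.
    apply: contraNneq neq_ij => eq_x; apply/eqP/val_inj => /=.
    by apply/eqP; rewrite -(eqn_pmul2r d_gt0); apply/eqP; lia.
  have eq_x : x + (i * d)%:Z = x + (i' * d)%:Z.
    by apply: (sidon_diff sS iS jS i'S j'S neq_x); lia.
  have eq_i : i = i' :> nat.
    by apply/eqP; rewrite -(eqn_pmul2r d_gt0); apply/eqP; lia.
  by congr pair; apply: val_inj => /=; lia.
rewrite -(card_in_imset h_inj); apply: leq_trans (max_card _) _.
by rewrite card_sum !card_ord; lia.
Qed.

(** Two values of [m] contributing to the sum would represent the same nonzero difference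
    [(i - j) * d] in [S], so they coincide. *)
Lemma sidon_corr_le1 (R : numDomainType) (S : {fset int}) (c : int) (d N i j : nat) :
  sidon S -> (0 < d)%N -> i != j ->
  \sum_(m < N) (m%:Z + c + (i * d)%:Z \in S)%:R * (m%:Z + c + (j * d)%:Z \in S)%:R
    <= 1 :> R.
Proof.
move=> sS d_gt0 neq_ij.
under eq_bigr do rewrite -natrM mulnb.
rewrite (sum_bool_card R (fun m : 'I_N => _ && _)) (ler_nat _ _ 1).
apply/card_le1_eqP => m m'; rewrite !unfold_in => /andP[miS mjS] /andP[m'iS m'jS].
have neq_d : (i * d)%N != (j * d)%N by rewrite eqn_pmul2r.
have neq : m%:Z + c + (i * d)%:Z != m%:Z + c + (j * d)%:Z.
  by apply: contraNneq neq_d => eq_m; apply/eqP; lia.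
have : m%:Z + c + (i * d)%:Z = m'%:Z + c + (i * d)%:Z.
  by apply: (sidon_diff sS miS mjS m'iS m'jS neq); lia.
by move=> eq_m; apply: val_inj => /=; lia.
Qed.

(** * Sums over progressions and intervals as indexed sums *)

Lemma AP_inj (x : int) (d : nat) : (0 < d)%N ->
  injective (fun i : nat => x + (i * d)%:Z).
Proof.
move=> d_gt0 i j /addrI [] /eqP; rewrite eqn_pmul2r // => /eqP //.
Qed.

Lemma big_fset_AP (R : nmodType) (g : int -> R) (x : int) (d k : nat) :
  (0 < d)%N ->
  \sum_(a <- [fset (x + (i * d)%:Z)%R | i in iota 0 k]%fset) g a
    = \sum_(i < k) g (x + (i * d)%:Z).
Proof.
move=> d_gt0; rewrite -(big_mkord xpredT (fun i => g (x + (i * d)%:Z))) /=.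
rewrite /index_iota subn0 -(big_map (fun i : nat => x + (i * d)%:Z) xpredT g).
apply/perm_big/uniq_perm; first exact: fset_uniq.
  by rewrite map_inj_uniq ?iota_uniq //; apply: AP_inj.
by move=> a; apply/imfsetP/mapP => -[i /= iP ->]; exists i.
Qed.

Lemma big_fsetI_mem (R : pzSemiRingType) (g : int -> R) (S P : {fset int}) :
  \sum_(a <- (S `&` P)%fset) g a = \sum_(a <- P) (a \in S)%:R * g a.
Proof.
under [RHS]eq_bigr => a _ do rewrite mulr_natl mulrb.
rewrite -big_mkcond -big_filter; apply/perm_big/uniq_perm.
- exact: fset_uniq.
- exact/filter_uniq/fset_uniq.
- by move=> a; rewrite mem_filter in_fsetI.
Qed.

Lemma sum_mem_interval (R : pzSemiRingType) (S : {fset int}) (x : int) (N : nat) :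
  {in S, forall a, x <= a < x + N%:Z} ->
  \sum_(m < N) (m%:Z + x \in S)%:R = #|` S|%:R :> R.
Proof.
move=> SN; pose P := [fset (x + (i * 1)%:Z)%R | i in iota 0 N]%fset.
have SP : (S `&` P)%fset = S.
  apply/fsetIidPl/fsubsetP => a /SN /andP[xa aN]; apply/imfsetP.
  by exists (`|a - x|)%N; rewrite /= ?mem_iota; lia.
have := big_fsetI_mem (fun=> 1 : R) S P.
rewrite SP big_fset_AP // big_const_seq count_predT iter_addr_0 => ->.
by apply: eq_bigr => m _; rewrite mulr1 muln1 addrC.
Qed.

(** * Quadratic sums and translates of a progression *)

Lemma sqr_sum_le (R : realFieldType) (k : nat) (g : 'I_k -> R) :
  (\sum_i g i) ^+ 2 <= k%:R * \sum_i g i ^+ 2.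
Proof.
rewrite expr2 big_distrlr /=.
apply: (@le_trans _ _ (\sum_i \sum_j (g i ^+ 2 / 2 + g j ^+ 2 / 2))).
  by apply: ler_sum => i _; apply: ler_sum => j _; have := sqr_ge0 (g i - g j); lra.
have E i : \sum_(j < k) (g i ^+ 2 / 2 + g j ^+ 2 / 2)
    = k%:R * (g i ^+ 2 / 2) + (\sum_j g j ^+ 2) / 2.
  by rewrite big_split sumr_const card_ord mulr_suml /= mulr_natl.
rewrite (eq_bigr _ (fun i _ => E i)) big_split sumr_const card_ord -mulr_sumr -mulr_suml /=.
by rewrite -mulr_natl; lra.
Qed.

Lemma sum_sqr_sub (R : comPzRingType) (k : nat) (g : 'I_k -> R) (c : R) :
  \sum_i (g i - c) ^+ 2 = \sum_i g i ^+ 2 - c *+ 2 * \sum_i g i + k%:R * c ^+ 2.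
Proof.
have E i : (g i - c) ^+ 2 = g i ^+ 2 - c *+ 2 * g i + c ^+ 2 by ring.
by rewrite (eq_bigr _ (fun i _ => E i)) big_split sumrB -mulr_sumr sumr_const card_ord mulr_natl.
Qed.

Lemma sum_shift (V : zmodType) (g : nat -> V) (k h : nat) :
  \sum_(i < k) g (i + h)%N - \sum_(i < k) g i
    = \sum_(i < h) g (i + k)%N - \sum_(i < h) g i.
Proof.
have E a b : \sum_(i < a + b) g i = \sum_(i < a) g i + \sum_(i < b) g (i + a)%N.
  by rewrite big_split_ord /=; congr (_ + _); apply: eq_bigr => i _; rewrite addnC.
have := E k h; rewrite addnC E => eq_g.
apply/eqP; rewrite subr_eq addrAC eq_sym subr_eq; apply/eqP.
by rewrite addrC -eq_g addrC.
Qed.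

(** Translation by [h] terms only exchanges one end block of [h] terms for another. Both block
    counts are nonnegative with square at most [3 * h], hence so is the square of their
    difference. *)
Lemma sidon_AP_shift (R : realFieldType) (S : {fset int}) (x : int) (d k h : nat) :
  sidon S -> (0 < d)%N ->
  (\sum_(i < k) (x + ((i + h) * d)%:Z \in S)%:R
   - \sum_(i < k) (x + (i * d)%:Z \in S)%:R : R) ^+ 2 <= 3 * h%:R.
Proof.
move=> sS d_gt0.
rewrite (sum_shift (fun i : nat => (x + (i * d)%:Z \in S)%:R : R)).
have H1 := @sidon_AP_card R S (x + (k * d)%:Z) d h sS d_gt0.
have H2 := @sidon_AP_card R S x d h sS d_gt0.
under eq_bigr => i _ do rewrite mulnDl addnC PoszD addrA.
move: H1 H2; set a := \sum_(i < h) _; set b := \sum_(i < h) _.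
have : 0 <= a by apply: sumr_ge0.
have : 0 <= b by apply: sumr_ge0.
move=> b0 a0 H1 H2; have [ab|ba] := leP a b; nra.
Qed.

(** * Variance of window counts and discrepancy on a progression *)

(** The square is expanded around [u s / n]. The last term on the right comes from summing over
    [n + u * d] window positions instead of [n]. *)
Lemma sidon_variance (R : realFieldType) (n : nat) (S : {fset int}) (d u : nat) :
  (0 < n)%N -> in_interval1 n S -> sidon S -> (0 < d)%N ->
  \sum_(m < n + u * d)
     (\sum_(h < u) (m%:Z + (1 - (u * d)%:Z) + (h * d)%:Z \in S)%:R
      - u%:R * #|` S|%:R / n%:R) ^+ 2
  <= u%:R * #|` S|%:R + u%:R ^+ 2 - u%:R ^+ 2 * #|` S|%:R ^+ 2 / n%:R
     + u%:R ^+ 3 * d%:R * #|` S|%:R ^+ 2 / n%:R ^+ 2 :> R.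
Proof.
move=> n_gt0 Sn sS d_gt0; set c := 1 - _; set s : R := #|` S|%:R.
pose f h (m : 'I_(n + u * d)) : R := (m%:Z + c + (h * d)%:Z \in S)%:R.
have sum_f (h : 'I_u) : \sum_m f h m = s.
  rewrite /s -(@sum_mem_interval R S (c + (h * d)%:Z) (n + u * d)).
    by apply: eq_bigr => m _; rewrite /f -[m%:Z + c + _]addrA.
  move=> a /Sn /andP[a1 an].
  have hu : (h * d <= u * d)%N by rewrite leq_mul2r ltnW ?orbT.
  by rewrite /c; lia.
have mean : \sum_m \sum_(h < u) f h m = u%:R * s.
  by rewrite exchange_big (eq_bigr _ (fun h _ => sum_f h)) sumr_const card_ord mulr_natl.
have second : \sum_m (\sum_(h < u) f h m) ^+ 2 <= u%:R * s + u%:R ^+ 2.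
  under eq_bigr do rewrite expr2 big_distrlr /=.
  rewrite exchange_big /=; under eq_bigr do rewrite exchange_big /=.
  (* Diagonal terms equal [s], off-diagonal ones are correlations bounded by 1; the extra 1 on the
     diagonal makes the total exactly [u s + u^2]. *)
  apply: (@le_trans _ _ (\sum_(h < u) \sum_(h' < u) ((h' == h)%:R * s + 1))).
    apply: ler_sum => h _; apply: ler_sum => h' _.
    case: eqVneq => [->|neq_h].
      under eq_bigr do rewrite /f -natrM mulnb andbb.
      by rewrite mul1r -(sum_f h) lerDl.
    by rewrite mul0r add0r sidon_corr_le1 // eq_sym.
  have E (h : 'I_u) : \sum_(h' < u) ((h' == h)%:R * s + 1) = s + u%:R.
    rewrite big_split /= sumr_const card_ord -mulr_suml; congr (_ + _).
    by rewrite (bigD1 h) //= eqxx big1 ?addr0 ?mul1r // => i /negPf ->.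
  rewrite (eq_bigr _ (fun h _ => E h)) sumr_const card_ord -mulr_natl; lra.
rewrite sum_sqr_sub -/(\sum_(h < u) f h _).
have n0 : n%:R != 0 :> R by rewrite pnatr_eq0 -lt0n.
rewrite [X in _ - _ * X](_ : _ = u%:R * s) //.
apply: le_trans (lerD (lerB second (lexx _)) (lexx _)) _.
rewrite natrD natrM le_eqVlt; apply/orP; left; apply/eqP; field.
exact: n0.
Qed.

Lemma ler_sum_inj (R : numDomainType) (I J : finType) (h : I -> J) (F : J -> R) :
  injective h -> (forall j, 0 <= F j) -> \sum_i F (h i) <= \sum_j F j.
Proof.
move=> h_inj F_ge0; rewrite -(big_imset F (in2W h_inj)) /=.
by rewrite [leRHS](bigID (mem [set h i | i in I])) /= lerDl sumr_ge0.
Qed.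

(** [Y] adds the deviations of the windows starting in the progression, [X] the errors from
    replacing each translate of the progression by the progression itself. Their difference is [u]
    times the discrepancy, and [(Y - X)^2 <= 2 X^2 + 2 Y^2]. Cauchy-Schwarz reduces [X] to the
    translation bound and [Y] to the variance. *)
Lemma sidon_AP_discrepancy (R : realFieldType) (n : nat) (S : {fset int})
    (x : int) (d k u : nat) :
  (0 < n)%N -> in_interval1 n S -> sidon S -> (0 < d)%N -> (0 < u)%N ->
  (forall i, (i < k)%N -> 1 <= x + (i * d)%:Z <= n%:Z) ->
  (\sum_(i < k) (x + (i * d)%:Z \in S)%:R - k%:R * (#|` S|%:R / n%:R)) ^+ 2
  <= 6 * u%:R
     + 2 * k%:R * (#|` S|%:R / u%:R + (1 - #|` S|%:R ^+ 2 / n%:R)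
                   + u%:R * d%:R * #|` S|%:R ^+ 2 / n%:R ^+ 2) :> R.
Proof.
move=> n_gt0 Sn sS d_gt0 u_gt0 xn; set s : R := #|` S|%:R.
set B := \sum_(i < k) _; pose mu : R := u%:R * s / n%:R.
pose f (i h : nat) : R := (x + ((i + h) * d)%:Z \in S)%:R.
pose A (i : 'I_k) := \sum_(h < u) f i h.
pose X := \sum_(h < u) (\sum_(i < k) f i h - B).
pose Y := \sum_(i < k) (A i - mu).
have X_le : X ^+ 2 <= u%:R * (u%:R * (3 * u%:R)).
  apply: le_trans (sqr_sum_le _) _; apply: ler_wpM2l => //.
  have E : \sum_(h < u) (3 * u%:R : R) = u%:R * (3 * u%:R).
    by rewrite sumr_const card_ord -[LHS]mulr_natl.
  rewrite -E; apply: ler_sum => h _.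
  apply: le_trans (sidon_AP_shift R x k h sS d_gt0) _.
  by rewrite ler_pM2l ?ltr0n // ler_nat ltnW ?ltn_ord.
have Y_le : Y ^+ 2 <= k%:R * (u%:R * s + u%:R ^+ 2 - u%:R ^+ 2 * s ^+ 2 / n%:R
     + u%:R ^+ 3 * d%:R * s ^+ 2 / n%:R ^+ 2).
  apply: le_trans (sqr_sum_le _) _; apply: ler_wpM2l => //.
  apply: le_trans _ (sidon_variance R u n_gt0 Sn sS d_gt0).
  (* The window starting at [x + i * d] has position [x + i * d - 1 + u * d]. These positions are
     distinct, so the variance over all positions dominates. *)
  have lt_N (i : 'I_k) : (`|(x + (i * d)%:Z - 1)%R| + u * d < n + u * d)%N.
    by have := xn i (ltn_ord i); lia.
  pose idx i := Ordinal (lt_N i).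
  pose F (m : 'I_(n + u * d)) :=
    (\sum_(h < u) (m%:Z + (1 - (u * d)%:Z) + (h * d)%:Z \in S)%:R - mu) ^+ 2.
  apply: le_trans _ (@ler_sum_inj R _ _ idx F _ _).
  - rewrite le_eqVlt; apply/orP; left; apply/eqP/eq_bigr => i _; congr ((_ - _) ^+ 2); apply: eq_bigr => h _.
    congr (nat_of_bool (_ \in S))%:R; rewrite mulnDl /=.
    by have := xn i (ltn_ord i); lia.
  - move=> i j [] eq_ij; apply/val_inj/(AP_inj d_gt0 (x := x)) => /=.
    by have := xn i (ltn_ord i); have := xn j (ltn_ord j); lia.
  - by move=> m; apply: sqr_ge0.
have YX : Y - X = u%:R * (B - k%:R * (s / n%:R)).
  rewrite /Y /X /A !sumrB !sumr_const !card_ord exchange_big /=.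
  by rewrite -[B *+ u]mulr_natl -[mu *+ k]mulr_natl /mu; ring.
have u0 : 0 < u%:R :> R by rewrite ltr0n.
have n0 : n%:R != 0 :> R by rewrite pnatr_eq0 -lt0n.
rewrite -(ler_pM2l (exprn_gt0 2 u0)) -exprMn -YX.
apply: (@le_trans _ _ (2 * X ^+ 2 + 2 * Y ^+ 2)).
  by have := sqr_ge0 (X + Y); lra.
apply: (le_trans (lerD (ler_wpM2l _ X_le) (ler_wpM2l _ Y_le))) => //.
rewrite le_eqVlt; apply/orP; left; apply/eqP; field.
by rewrite n0 lt0r_neq0.
Qed.

(** * Abel summation *)

(** The least weight [w 0] is split off and multiplies the full sum, at cost [w 0 * E]. What is left
    has nondecreasing weights in [[0, M - w 0]] and its tails are tails of [c], so induction on [k]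
    with [M] varying adds up to [M * E]. *)
Lemma abel_sum_le (R : realDomainType) (E M : R) (k : nat) (w c : nat -> R) :
  0 <= E -> (forall i, (i < k)%N -> 0 <= w i <= M) ->
  (forall i, (i.+1 < k)%N -> w i <= w i.+1) ->
  (forall j, (j <= k)%N -> `|\sum_(i < k - j) c (j + i)%N| <= E) ->
  0 <= M ->
  `|\sum_(i < k) w i * c i| <= M * E.
Proof.
move=> E0; elim: k M w c => [|k IH] M w c wM w_homo tail M0.
  by rewrite big_ord0 normr0 mulr_ge0.
have /andP[w0 w0M] := wM 0%N isT.
have w_ge i : (i < k.+1)%N -> w 0%N <= w i.
  by elim: i => // i IHi lt_ik; apply: le_trans (IHi (ltnW lt_ik)) (w_homo _ lt_ik).
have -> : \sum_(i < k.+1) w i * c i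
    = w 0%N * \sum_(i < k.+1) c i + \sum_(i < k) (w i.+1 - w 0%N) * c i.+1.
  rewrite mulr_sumr !big_ord_recl /= -addrA; congr (_ + _).
  by rewrite -big_split /=; apply: eq_bigr => i _; rewrite /bump /= !add1n; ring.
apply: le_trans (ler_normD _ _) _.
have T0 : `|\sum_(i < k.+1) c i| <= E by have := tail 0%N isT; rewrite subn0.
have IH' : `|\sum_(i < k) (w i.+1 - w 0%N) * c i.+1| <= (M - w 0%N) * E.
  apply: (IH (M - w 0%N) (fun i => w i.+1 - w 0%N) (fun i => c i.+1)).
  - move=> i ik; have /andP[_ wiM] := wM i.+1 ik.
    by have := w_ge i.+1 ik; rewrite subr_ge0 => ->; rewrite lerB.
  - by move=> i ik; rewrite lerB // w_homo.
  - by move=> j jk; have := tail j.+1 jk; rewrite subSS.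
  - by rewrite subr_ge0.
rewrite normrM ger0_norm //; nra.
Qed.

(** * Explicit bounds in terms of [n^(1/4)] and [Phi] *)

Lemma sidon_card_sqr (R : numDomainType) (n : nat) (S : {fset int}) :
  in_interval1 n S -> sidon S -> #|` S|%:R ^+ 2 <= 3 * n%:R :> R.
Proof.
move=> Sn sS; apply: le_trans _ (@sidon_AP_card R S 1 1 n sS isT).
rewrite -(@sum_mem_interval R S 1 n); last by move=> a /Sn /andP[? ?]; lia.
by under eq_bigr => i _ do rewrite addrC -[i in i%:Z]muln1.
Qed.

Lemma sidon_AP_discrepancy_root4 (R : realType) (n : nat) (S : {fset int})
    (x : int) (d k : nat) (t : R) :
  1 <= t -> t ^+ 4 = n%:R ->
  in_interval1 n S -> sidon S -> (0 < d)%N ->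
  (forall i, (i < k)%N -> 1 <= x + (i * d)%:Z <= n%:Z) ->
  (\sum_(i < k) (x + (i * d)%:Z \in S)%:R - k%:R * (#|` S|%:R / n%:R)) ^+ 2
  <= 64 * (t ^+ 4 * `|1 - #|` S|%:R / t ^+ 2| + t ^+ 3).
Proof.
move=> t1 tn Sn sS d_gt0 xn.
have t0 : 0 < t by lra.
have t3t : t <= t ^+ 3 by rewrite -[leLHS]expr1 ler_weXn2l.
have t23 : t ^+ 2 <= t ^+ 3 by rewrite ler_weXn2l.
have n_gt0 : (0 < n)%N by rewrite -(ltr0n R) -tn exprn_gt0.
have d0 : 0 < d%:R :> R by rewrite ltr0n.
have := sidon_card_sqr R Sn sS; set s : R := #|` S|%:R => s3.
have s_ge0 : 0 <= s by rewrite ler0n.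
pose z := s / t ^+ 2.
have sE : s = z * t ^+ 2 by rewrite divfK // expf_neq0 // lt0r_neq0.
have z0 : 0 <= z by rewrite divr_ge0 // exprn_ge0 // ltW.
have z3 : z ^+ 2 <= 3.
  by rewrite -(ler_pM2r (exprn_gt0 4 t0)) tn; apply: le_trans s3; rewrite sE -tn; nra.
have z2 : z <= 2 by nra.
rewrite -/z; have delta0 : 0 <= `|1 - z| by [].
(* From here the progression has [k.+1] terms, so that [k * d] is the distance between its ends. *)
case: k xn => [|k] xn.
  rewrite big_ord0 mul0r subr0 expr0n /=.
  by rewrite mulr_ge0 // addr_ge0 ?mulr_ge0 ?exprn_ge0 // ltW.
have kd : k%:R * d%:R <= t ^+ 4.
  rewrite tn -natrM ler_nat; have := xn 0%N isT; have := xn k (ltnSn k); lia.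
(* For [d > t^3] there are at most [t + 1] terms; the count and its expected value both lie in
   [[0, 4 t]], and [16 t^2 <= 64 t^3]. *)
have [dt|td] := leP d%:R (t ^+ 3); last first.
  have kt : k%:R <= t by nra.
  have B0 : 0 <= \sum_(i < k.+1) (x + (i * d)%:Z \in S)%:R :> R by apply: sumr_ge0.
  have Bk : \sum_(i < k.+1) (x + (i * d)%:Z \in S)%:R <= k.+1%:R :> R.
    rewrite -[k.+1 in leRHS]card_ord -sumr_const; apply: ler_sum => i _.
    by case: (_ \in _).
  have K4 : k.+1%:R * (s / n%:R) <= 4 * t.
    rewrite sE -tn (_ : z * t ^+ 2 / t ^+ 4 = z / t ^+ 2); last first.
      by field; rewrite lt0r_neq0.
    rewrite -natr1 mulrA ler_pdivrMr ?exprn_gt0 //.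
    by apply: (@le_trans _ _ (2 * t * 2)); [apply: ler_pM => //; lra | nra].
  have K0 : 0 <= k.+1%:R * (s / n%:R) by rewrite mulr_ge0 ?divr_ge0.
  move: B0 Bk K4 K0; rewrite -natr1.
  set B := \sum_(i < k.+1) _; set K := _ * (s / _) => B0 Bk K4 K0.
  have up : 0 <= 4 * t - (B - K) by lra.
  have lo : 0 <= 4 * t + (B - K) by lra.
  have := mulr_ge0 up lo.
  have : 0 <= t ^+ 4 * `|1 - z| by rewrite mulr_ge0 ?exprn_ge0 // ltW.
  nra.
(* The window length [u] is the integer part of [v] plus one, so [v < u <= 2 v]. As [k.+1 <= 2 t v],
   this choice makes the [s / u] term contribute [O(t^3)], while the terms of order [u] stay
   [O(t^3)] because [v <= t^3]. *)
pose v := t ^+ 3 / d%:R.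
have vd : v * d%:R = t ^+ 3 by rewrite divfK // lt0r_neq0.
have v1 : 1 <= v by rewrite ler_pdivlMr // mul1r.
have vt : v <= t ^+ 3.
  by rewrite ler_pdivrMr // ler_peMr ?exprn_ge0 ?ler1n // ltW.
have v_ge0 : 0 <= v by lra.
have /andP[uv vu] := truncn_itv v_ge0.
set u := (Num.truncn v).+1 in vu.
have u2v : u%:R <= 2 * v by rewrite /u -natr1; lra.
have k2 : k.+1%:R <= 2 * (t * v) by rewrite -natr1; nra.
apply: le_trans (sidon_AP_discrepancy R n_gt0 Sn sS d_gt0 (isT : (0 < u)%N) xn) _.
rewrite -/s -tn.
have u0 : 0 < u%:R :> R by lra.
have v0 : 0 < v by lra.
have T1 : s / u%:R <= 2 * t ^+ 2 / v.
  apply: ler_pM => //.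
    by rewrite sE ler_wpM2r ?exprn_ge0 // ltW.
  by rewrite lef_pV2 // ltW.
(* This is [1 - z^2 = (1 - z) (1 + z)] with [1 + z <= 3]; for [z > 1] the left side is negative. *)
have T2 : 1 - s ^+ 2 / t ^+ 4 <= 3 * `|1 - z|.
  have -> : s ^+ 2 / t ^+ 4 = z ^+ 2 by rewrite sE; field; rewrite lt0r_neq0.
  have := ler_norm (1 - z); nra.
have T3 : u%:R * d%:R * s ^+ 2 / (t ^+ 4) ^+ 2 <= 6 / t.
  have -> : u%:R * d%:R * s ^+ 2 / (t ^+ 4) ^+ 2 = u%:R * d%:R * z ^+ 2 / t ^+ 4.
    by rewrite sE; field; rewrite lt0r_neq0.
  rewrite ler_pdivrMr ?exprn_gt0 // (_ : 6 / t * t ^+ 4 = 2 * t ^+ 3 * 3); last first.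
    by field; rewrite lt0r_neq0.
  apply: ler_pM; rewrite ?sqr_ge0 ?z3 //.
  by rewrite -vd mulrA ler_wpM2r // ltW.
set G := _ + _ + _.
have G_le : G <= 2 * t ^+ 2 / v + 3 * `|1 - z| + 6 / t by rewrite /G !lerD.
have kG : k.+1%:R * G <= 8 * t ^+ 3 / 2 + 6 * (t * v * `|1 - z|) + 12 * v.
  apply: (@le_trans _ _ (2 * (t * v) * (2 * t ^+ 2 / v + 3 * `|1 - z| + 6 / t))).
    apply: (le_trans (ler_wpM2l _ G_le)) => //; apply: ler_wpM2r k2.
    by rewrite !addr_ge0 ?divr_ge0 ?mulr_ge0 ?exprn_ge0 // ltW.
  rewrite le_eqVlt; apply/orP; left; apply/eqP; field.
  by rewrite !lt0r_neq0.
have tv : t * v * `|1 - z| <= t ^+ 4 * `|1 - z|.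
  by rewrite ler_wpM2r // [t ^+ 4]exprS ler_wpM2l // ltW.
rewrite -mulrA; have : 0 <= t ^+ 4 * `|1 - z| by rewrite mulr_ge0 ?exprn_ge0 // ltW.
lra.
Qed.

Lemma sidon_AP_discrepancy_Phi (R : realType) (n : nat) (S : {fset int})
    (x : int) (d k : nat) :
  (0 < n)%N -> in_interval1 n S -> sidon S -> (0 < d)%N ->
  (forall i, (i < k)%N -> 1 <= x + (i * d)%:Z <= n%:Z) ->
  `|\sum_(i < k) ((x + (i * d)%:Z \in S)%:R - #|` S|%:R / n%:R)| <= 8 * Phi R S n.
Proof.
move=> n_gt0 Sn sS d_gt0 xn.
have n0 : 0 < n%:R :> R by rewrite ltr0n.
pose t : R := n%:R `^ (1 / 4).
have t0 : 0 < t by rewrite powR_gt0.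
have t4 : t ^+ 4 = n%:R.
  by rewrite -powR_mulrn ?ltW // -powRrM (_ : 1 / 4 * 4%:R = 1) ?powRr1 ?ltW //; field.
have t2 : t ^+ 2 = n%:R `^ (1 / 2).
  by rewrite -powR_mulrn ?ltW // -powRrM; congr (_ `^ _); field.
have t1 : 1 <= t.
  by rewrite -(@ler_pXn2r _ 4%N) ?nnegrE ?(ltW t0) // expr1n t4 ler1n.
have tV : n%:R `^ (- (1 / 4)) = t^-1 by rewrite powRN.
have Phi_ge0 : 0 <= Phi R S n by rewrite mulr_ge0 ?powR_ge0.
(* Up to the factor 64, this is the bound already obtained for the squared discrepancy; the constant
   8 is the square root of 64. *)
have Phi_sqr : Phi R S n ^+ 2 = t ^+ 4 * `|1 - #|` S|%:R / t ^+ 2| + t ^+ 3.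
  rewrite /Phi -t2 tV exprMn -[X in _ * X]powR_mulrn ?powR_ge0 // -powRrM.
  rewrite (_ : 1 / 2 * 2%:R = 1); last by field.
  rewrite powRr1; last by rewrite addr_ge0 ?invr_ge0 ?(ltW t0).
  by field; rewrite lt0r_neq0.
have := sidon_AP_discrepancy_root4 t1 t4 Sn sS d_gt0 xn.
rewrite -Phi_sqr -[64](_ : 8 ^+ 2 = _); last by ring.
rewrite -exprMn -[X in X <= _]real_normK ?num_real // ler_pXn2r ?nnegrE ?mulr_ge0 //.
by rewrite sumrB sumr_const card_ord mulr_natl.
Qed.

Theorem theorem1 (R : realType) (l : nat) :
  exists C : R, 0 < C /\
    forall (n : nat) (S P : {fset int}),
      (0 < n)%N ->
      in_interval1 n S -> sidon S ->
      in_interval1 n P -> finite_AP P ->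
      `| \sum_(a <- (S `&` P)%fset) (a%:~R : R) ^+ l
         - #|` S|%:R / n%:R * \sum_(a <- P) (a%:~R : R) ^+ l |
        <= C * n%:R ^+ l * Phi R S n * ln (2 * n%:R).
Proof.
have ln2 : 0 < ln 2 :> R by rewrite ln_gt0 // ltr1n.
(* Abel summation yields [8 n^l Phi]; dividing by [ln 2] compensates for the factor [ln (2 * n%:R)],
   which is at least [ln 2]. *)
exists (8 / ln 2); split; first by rewrite divr_gt0.
move=> n S P n_gt0 Sn sS Pn [x [[d|d] [k [d_ge1 PE]]]] //.
have d_gt0 : (0 < d)%N by [].
have {}PE : P = [fset (x + (i * d)%:Z)%R | i in iota 0 k]%fset.
  by rewrite PE; apply: eq_imfset => // i; rewrite PoszM.
have xn i : (i < k)%N -> 1 <= x + (i * d)%:Z <= n%:Z.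
  by move=> ik; apply: Pn; rewrite PE; apply/imfsetP; exists i; rewrite ?mem_iota.
have Phi_ge0 : 0 <= Phi R S n by rewrite mulr_ge0 ?powR_ge0.
pose w (i : nat) : R := (x + (i * d)%:Z)%:~R ^+ l.
pose c (i : nat) : R := (x + (i * d)%:Z \in S)%:R - #|` S|%:R / n%:R.
have -> : \sum_(a <- (S `&` P)%fset) (a%:~R : R) ^+ l
    - #|` S|%:R / n%:R * \sum_(a <- P) (a%:~R : R) ^+ l = \sum_(i < k) w i * c i.
  rewrite big_fsetI_mem mulr_sumr -sumrB PE big_fset_AP //.
  by apply: eq_bigr => i _; rewrite /w /c; ring.
apply: (@le_trans _ _ (n%:R ^+ l * (8 * Phi R S n))).
  apply: abel_sum_le; rewrite ?mulr_ge0 ?exprn_ge0 //.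
  - move=> i /xn /andP[x1 x2].
    have x0 : 0 <= (x + (i * d)%:Z)%:~R :> R by rewrite ler0z; lia.
    by rewrite exprn_ge0 //= lerXn2r ?nnegrE // -[n%:R]/(n%:Z%:~R) ler_int.
  - move=> i ik; have /andP[x1 _] := xn i (ltnW ik); have /andP[x1' _] := xn _ ik.
    rewrite lerXn2r ?nnegrE ?ler0z ?ler_int; lia.
  (* A tail of the progression is the progression of [k - j] terms starting at [x + j * d], so the
     unweighted bound applies to it. *)
  - move=> j jk.
    have := @sidon_AP_discrepancy_Phi R n S (x + (j * d)%:Z) d (k - j) n_gt0 Sn sS d_gt0.
    under eq_bigr => i _ do rewrite -addrA -PoszD -mulnDl.
    by apply=> i ik; rewrite -addrA -PoszD -mulnDl xn //; lia.
rewrite -[8 in leLHS](divfK (lt0r_neq0 ln2)).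
rewrite [leRHS](_ : _ = n%:R ^+ l * (8 / ln 2 * ln (2 * n%:R) * Phi R S n)); last by ring.
rewrite ler_wpM2l ?exprn_ge0 // ler_wpM2r // ler_wpM2l ?divr_ge0 ?(ltW ln2) //.
by rewrite ler_ln ?posrE ?mulr_gt0 ?ltr0n // ler_peMr // ler1n.
Qed.
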